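(* Let $X\sim\mathcal{B}2(p,q,\beta)$ be a random variable with a second kind beta distribution. Then the conditional tail moments of $X$ are given by $$E[X^r\mid X>x_u]=\frac{\beta^r\,\Gamma(p+r)\Gamma(q-r)}{(1-u)\Gamma(p)\Gamma(q)}\left\{1-B\!\left(\frac{x_u/\beta}{1+x_u/\beta};\,p+r,\,q-r\right)\right\},$$ where $x_u=\mathrm{VaR}[X;u]$ is the value at risk of $X$ at level $u\in(0,1)$, and $B(\cdot\,;\cdot,\cdot)$, with three arguments, denotes the incomplete beta function ratio.
   Context: For $p,q,\beta>0$, $\mathcal{B}2(p,q,\beta)$ is the distribution with density $\frac{x^{p-1}}{\beta^pB(p,q)(1+x/\beta)^{p+q}}$ for $x>0$ and $0$ for $x<0$, where $B(p,q)=\Gamma(p)\Gamma(q)/\Gamma(p+q)$ is the beta function. For a random variable $X$ with cumulative distribution function $F$ and $0<u<1$, the value at risk is $\mathrm{VaR}[X;u]=\inf\{x\in\mathbb{R}: F(x)\ge u\}$. The incomplete beta function ratio is $B(z;a,b)=\frac{1}{B(a,b)}\int_0^z t^{a-1}(1-t)^{b-1}\,dt$, i.e. the cumulative distribution function of the classical (first kind) beta distribution with parameters $a,b$. *)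

(* Defs.v *)
From HB Require Import structures.
From mathcomp Require Import all_boot all_order all_algebra.
From mathcomp Require Import all_classical all_reals all_analysis.

Set Implicit Arguments.
Unset Strict Implicit.
Unset Printing Implicit Defensive.

Import Order.TTheory GRing.Theory Num.Theory.
Import numFieldNormedType.Exports.

Local Open Scope classical_set_scope.
Local Open Scope ring_scope.

(* The library's [beta_fun] only takes natural-number parameters; the three
   functions below take real ones and are meant for [0 < a] and [0 < b]. *)

Definition Gamma {R : realType} (a : R) : R :=
  \int[@lebesgue_measure R]_(t in `]0, +oo[) (t `^ (a - 1) * expR (- t)).

Definition Beta {R : realType} (a b : R) : R :=
  Gamma a * Gamma b / Gamma (a + b).

Definition inc_beta_ratio {R : realType} (z a b : R) : R :=
  (Beta a b)^-1 *
  \int[@lebesgue_measure R]_(t in `[0, z]) (t `^ (a - 1) * (1 - t) `^ (b - 1)).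

(* The value at 0 is immaterial: it does not affect the distribution. *)
Definition beta2_pdf {R : realType} (p q beta x : R) : R :=
  if 0 < x then
    x `^ (p - 1) / (beta `^ p * Beta p q * (1 + x / beta) `^ (p + q))
  else 0.

Definition beta2_distributed {d : measure_display} {T : measurableType d}
    {R : realType} {P : probability T R} (X : {RV P >-> R}) (p q beta : R) :
    Prop :=
  forall A : set R, measurable A ->
    distribution P X A =
      (\int[@lebesgue_measure R]_(x in A) (beta2_pdf p q beta x)%:E)%E.

(* For [0 < u < 1] the set is nonempty and bounded below, so that [inf] is its
   genuine infimum. *)
Definition VaR {d : measure_display} {T : measurableType d} {R : realType}
    {P : probability T R} (X : {RV P >-> R}) (u : R) : R :=
  inf [set x : R | (u%:E <= cdf X x)%E].

(* Elementary conditional expectation given an event [A] with [0 < P A]. *)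
Definition cond_expectation {d : measure_display} {T : measurableType d}
    {R : realType} (P : probability T R) (Y : T -> R) (A : set T) : \bar R :=
  ('E_P[(fun w => Y w * \1_A w)%R] / P A)%E.

(* Main.v *)
(* With a = p + r and b = q - r, the substitution x = beta y turns the truncated
   moments of the density into integrals of y^(a-1) / (1+y)^(a+b).  Over the
   whole half-line this integral is Gamma(a) Gamma(b) / Gamma(a+b): integrate
   x^(a-1) t^(a+b-1) exp(-(1+x)t) over both variables in either order, each
   inner integral being a rescaled Gamma integral.  Over ]0, v[ the substitution
   t = y / (1+y) yields the incomplete beta integral up to v / (1+v), and the
   tail is the difference.  The law has no atoms, so the distribution function
   takes exactly the value u at the value at risk. *)
Require Import Defs.
From HB Require Import structures.
From mathcomp Require Import all_boot all_order all_algebra.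
From mathcomp Require Import all_classical all_reals all_analysis.
From mathcomp Require Import measurable_realfun ring lra.

Set Implicit Arguments.
Unset Strict Implicit.

Import Order.TTheory GRing.Theory Num.Theory.
Import numFieldNormedType.Exports.

Local Open Scope classical_set_scope.
Local Open Scope ring_scope.

(** * Change of variables over an open set exhausted by compact segments *)

Section substitution.
Context {R : realType}.
Notation mu := (@lebesgue_measure R).
Implicit Types (F f G : R -> R).

(** On each segment [[a_ n, b_ n]] the classical substitution formula applies; monotone convergence
    then passes to the union on both sides. Hypotheses bear on points of [I] only, so [I] may be
    unbounded and the integrand may blow up at its ends. *)
Lemma ge0_integration_by_substitution_bigcup F f G (a_ b_ : R^nat) :
  let I := \bigcup_n `[a_ n, b_ n]%classic in
  open I -> nonincreasing_seq a_ -> nondecreasing_seq b_ ->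
  (forall n, a_ n <= b_ n) ->
  {in I &, {homo F : x y / x < y}} ->
  (forall x, I x -> is_derive x 1 F (f x)) ->
  (forall x, I x -> 0 <= f x) ->
  (forall x, I x -> {for x, continuous f}) ->
  (forall x, I x -> 0 <= G (F x)) ->
  (forall x, I x -> {for F x, continuous G}) ->
  (\int[mu]_(y in F @` I) (G y)%:E = \int[mu]_(x in I) (G (F x) * f x)%:E)%E.
Proof.
move=> I oI na nb ab homoF dF f0 cf G0 cG.
have abI n : `[a_ n, b_ n]%classic `<=` I by move=> x xab; exists n.
have aI n x : x \in `[a_ n, b_ n] -> I x by move=> ?; exact: (abI n).
have cF x : I x -> {for x, continuous F}.
  move=> Ix; apply/differentiable_continuous/derivable1_diffP.
  by case: (dF x Ix).
have cFn n : {within `[a_ n, b_ n], continuous F}.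
  apply: continuous_in_subspaceT => x /set_mem xab; exact/cF/(aI n).
have f'E x : I x -> F^`()%classic x = f x.
  by move=> Ix; rewrite derive1E; case: (dF x Ix).
(* Since [I] is open, the derivative of [F] coincides with [f] on a neighbourhood of [x], and so
   inherits the continuity of [f] at [x]. *)
have f'near x : I x -> \near x, F^`()%classic x = f x.
  move=> Ix; near=> y; apply: f'E; near: y; exact: open_nbhs_nbhs.
have cf' x : I x -> {for x, continuous F^`()%classic}.
  move=> Ix; rewrite /prop_for /continuous_at f'E//.
  apply: cvg_trans (cf x Ix); apply: near_eq_cvg.
  by apply: filterS (f'near x Ix) => y /= ->.
have mem_a n : a_ n \in `[a_ n, b_ n] by rewrite in_itv/= lexx ab.
have mem_b n : b_ n \in `[a_ n, b_ n] by rewrite in_itv/= lexx ab.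
have leF n : {in `[a_ n, b_ n] &, {homo F : x y / x <= y}}.
  move=> x y xab yab; rewrite le_eqVlt => /predU1P[->//|xy].
  by apply/ltW/homoF => //; apply/mem_set/(aI n).
have imF n : F @` `[a_ n, b_ n] = `[F (a_ n), F (b_ n)]%classic.
  apply: (inc_surj_image_segment (ab n) (@leF n)).
  move=> y /=; rewrite in_itv/= => /andP[Fay yFb].
  have [|c cab <-] := @IVT R F _ _ y (ab n) (cFn n); last by exists c.
  by rewrite ge_min Fay le_max yFb orbT.
have cGn n : {within `[F (a_ n), F (b_ n)], continuous G}.
  rewrite -imF; apply: continuous_in_subspaceT => y /set_mem[x xab <-].
  exact/cG/(aI n).
have stepE n : (\int[mu]_(y in `[F (a_ n), F (b_ n)]) (G y)%:E =
                \int[mu]_(x in `[a_ n, b_ n]) (G (F x) * f x)%:E)%E.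
  rewrite (@integration_by_substitution_increasing R F G (a_ n) (b_ n))//.
  - apply: eq_integral => x /set_mem xab /=; congr EFin.
    by rewrite !fctE f'E//; exact: aI xab.
  - by move=> x y xab yab; apply: homoF; apply/mem_set/(aI n).
  - move=> x xab; apply/cf'/(aI n); exact: subset_itv_oo_cc xab.
  - apply/cvg_ex; exists (F^`()%classic (a_ n)).
    by apply/cvg_at_right_filter/cf'/(aI n).
  - apply/cvg_ex; exists (F^`()%classic (b_ n)).
    by apply/cvg_at_left_filter/cf'/(aI n).
  - split.
    + by move=> x xab; case: (dF x (aI _ _ (subset_itv_oo_cc xab))).
    + by apply/cvg_at_right_filter/cF/(aI n).
    + by apply/cvg_at_left_filter/cF/(aI n).
have ndI : nondecreasing_seq (fun n => `[a_ n, b_ n]%classic).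
  move=> m n mn; apply/subsetPset => x /=; rewrite !in_itv/= => /andP[ax xb].
  by rewrite (le_trans (na _ _ mn) ax) (le_trans xb (nb _ _ mn)).
have ndFI : nondecreasing_seq (fun n => `[F (a_ n), F (b_ n)]%classic).
  move=> m n mn; apply/subsetPset; rewrite -!imF; apply: image_subset.
  by apply/subsetPset; exact: ndI.
have -> : F @` I = \bigcup_n `[F (a_ n), F (b_ n)]%classic.
  by rewrite image_bigcup; apply: eq_bigcupr => n _; exact: imF.
have cvgL :
  (\int[mu]_(y in `[F (a_ n), F (b_ n)]) (G y)%:E @[n --> \oo] -->
   \int[mu]_(y in \bigcup_n `[F (a_ n), F (b_ n)]%classic) (G y)%:E)%E.
  apply: ge0_nondecreasing_set_cvg_integral => // n.
  - by apply/measurable_EFinP; apply: subspace_continuous_measurable_fun.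
  - by move=> y; rewrite -imF => -[x xab <-]; rewrite lee_fin; exact/G0/(aI n).
rewrite -(cvg_lim _ cvgL)//; under eq_fun do rewrite stepE.
apply/cvg_lim => //; apply: ge0_nondecreasing_set_cvg_integral => // n.
- apply/measurable_EFinP; apply: subspace_continuous_measurable_fun => //.
  apply: continuous_in_subspaceT => x /set_mem/(aI n) Ix.
  apply: (@continuousM _ _ (G \o F)); last exact: cf.
  by apply: continuous_comp; [exact: cF|exact: cG].
- by move=> x /(aI n) Ix; rewrite lee_fin mulr_ge0 ?G0 ?f0.
Unshelve. all: by end_near. Qed.

End substitution.

(** * Open intervals with left end 0, and scaling on them *)

Section open_itv0.
Context {R : realType}.
Notation mu := (@lebesgue_measure R).
Implicit Types (F f G : R -> R) (b : itv_bound R).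

(** As a right end, [BLeft v] excludes [v]: the intervals meant are []0, +oo[] and []0, v[], treated
    together from here on. *)
Definition open_right b := b = +oo%O \/ exists2 v, 0 < v & b = BLeft v.

Lemma open_right_exhaustion b : open_right b -> exists a_ b_ : R^nat,
  [/\ nonincreasing_seq a_, nondecreasing_seq b_, (forall n, a_ n <= b_ n) &
      \bigcup_n `[a_ n, b_ n]%classic = [set` Interval (BRight 0) b]].
Proof.
have le_inv m n k : (m <= n)%N -> (n + k.+1)%:R^-1 <= (m + k.+1)%:R^-1 :> R.
  by move=> mn; rewrite lef_pV2 ?posrE ?ltr0n ?addnS// ler_nat ltnS leq_add2r.
have ltr_truncnS (x : R) n : (Num.truncn x <= n)%N -> x < n.+1%:R.
  move=> xn; apply: (lt_le_trans (truncnS_gt x)).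
  by rewrite ler_nat ltnS.
case=> [->|[v v0 ->]].
- exists (fun n => (n + 1)%:R^-1), (fun n => (n + 1)%:R); split.
  + by move=> m n mn; exact: le_inv.
  + by move=> m n mn; rewrite ler_nat leq_add2r.
  + by move=> n; rewrite addn1 (@le_trans _ _ 1)// ?invf_le1// ler1n.
  + apply/seteqP; split=> [x [n _ /=]|x /=]; rewrite !in_itv/= ?andbT.
      by case/andP=> + _; apply: lt_le_trans; rewrite invr_gt0 ltr0n addn1.
    (* Both [x] and [x^-1] are below [n + 1] as soon as [n] is at least their truncations. *)
    move=> x0; exists (maxn (Num.truncn x) (Num.truncn x^-1)) => //=.
    rewrite in_itv/= addn1; apply/andP; split.
      rewrite invf_ple ?posrE// ltW// ltr_truncnS// leq_maxr//.
    by rewrite ltW// ltr_truncnS// leq_maxl.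
(* With the shift by 2 the first segment is the single point [v / 2]; a shift by 1 would start with
   the ends [v] and [0] in the wrong order. *)
- exists (fun n => v * (n + 2)%:R^-1), (fun n => v * (1 - (n + 2)%:R^-1)).
  split.
  + by move=> m n mn; rewrite ler_pM2l// le_inv.
  + by move=> m n mn; rewrite ler_pM2l// lerB// le_inv.
  + move=> n; rewrite ler_pM2l// lerBrDr -mulr2n -[_ *+ 2]mulr_natl.
    by rewrite ler_pdivrMr ?mul1r ?ler_nat ?leq_addl// addn2.
  + have inv_lt1 n : 0 < ((n + 2)%:R^-1 : R) < 1.
      by rewrite addn2 invr_gt0 ltr0n invf_lt1// ltr1n.
    apply/seteqP; split=> [x [n _ /=]|x /=]; rewrite !in_itv/=.
      have /andP[i0 i1] := inv_lt1 n; case/andP=> vx xv; apply/andP; split.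
        by apply: lt_le_trans vx; rewrite mulr_gt0.
      by apply: le_lt_trans xv _; rewrite gtr_pMr// ltrBlDr ltrDl.
    case/andP=> x0 xv; have vx0 : 0 < v - x by rewrite subr_gt0.
    (* Membership of [x] means [v / (N + 2) <= x] and [v / (N + 2) <= v - x]; each truncation
       secures one of the two. *)
    exists (maxn (Num.truncn (v / x)) (Num.truncn (v / (v - x)))) => //=.
    rewrite in_itv/= !addn2; set N := maxn _ _.
    have N0 : 0 < N.+2%:R :> R by rewrite ltr0n.
    have Nx y : 0 < y -> (Num.truncn (v / y) <= N)%N -> v / N.+2%:R <= y.
      move=> y0 /ltr_truncnS; rewrite ltr_pdivrMr// => vN.
      rewrite ler_pdivrMr// (le_trans (ltW vN))// mulrC ler_pM2l//.
      by rewrite ler_nat.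
    rewrite Nx ?leq_maxl//= mulrBr mulr1 lerBrDl -lerBrDr.
    by rewrite Nx// leq_maxr.
Qed.

Lemma ge0_integration_by_substitution_itv0 F f G b : open_right b ->
  let I := [set` Interval (BRight 0) b] in
  {in I &, {homo F : x y / x < y}} ->
  (forall x, I x -> is_derive x 1 F (f x)) ->
  (forall x, I x -> 0 <= f x) ->
  (forall x, I x -> {for x, continuous f}) ->
  (forall x, I x -> 0 <= G (F x)) ->
  (forall x, I x -> {for F x, continuous G}) ->
  (\int[mu]_(y in F @` I) (G y)%:E = \int[mu]_(x in I) (G (F x) * f x)%:E)%E.
Proof.
move=> hb I; have oI : open I.
  by rewrite /I; case: hb => [->|[v _ ->]]; exact: interval_open.
move: oI; rewrite {}/I.
have [a_ [b_ [na nb ab <-]]] := open_right_exhaustion hb.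
by move=> ? *; exact: ge0_integration_by_substitution_bigcup.
Qed.

Lemma mem_itv0_gt0 b x : [set` Interval (BRight 0) b] x -> 0 < x.
Proof. by rewrite /= itv_boundlr/= => /andP[]; rewrite bnd_simp. Qed.

Lemma ge0_integral_itv0_scale G c b : 0 < c -> open_right b ->
  let I := [set` Interval (BRight 0) b] in
  (forall x, 0 < x -> 0 <= G x) ->
  (forall x, 0 < x -> {for x, continuous G}) ->
  (\int[mu]_(y in *%R c @` I) (G y)%:E =
   \int[mu]_(x in I) (G (c * x) * c)%:E)%E.
Proof.
move=> c0 hb I G0 cG.
apply: (@ge0_integration_by_substitution_itv0 _ (cst c))
  => // [x y _ _||x _|x|x|x].
- by rewrite ltr_pM2l.
- move=> x _; apply: is_derive_eq.
  by rewrite !scaler1 /cst //= ?scaler0 ?addr0.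
- exact: ltW.
- by move=> _; exact: cvg_cst.
- by move/mem_itv0_gt0 => x0; apply: G0; rewrite mulr_gt0.
- by move/mem_itv0_gt0 => x0; apply: cG; rewrite mulr_gt0.
Qed.

Lemma image_scale_itv0y (c : R) : 0 < c ->
  *%R c @` `]0, +oo[ = `]0, +oo[%classic.
Proof.
move=> c0; apply/seteqP; split=> [_ [x /= x0 <-]|x /=].
  by move: x0; rewrite !in_itv/= !andbT; exact: mulr_gt0.
rewrite in_itv/= andbT => x0.
exists (x / c); last by rewrite mulrC divfK ?gt_eqF.
by rewrite /= in_itv/= andbT divr_gt0.
Qed.

Lemma image_scale_itv0o (c v : R) : 0 < c ->
  *%R c @` `]0, v[ = `]0, c * v[%classic.
Proof.
move=> c0; apply/seteqP; split=> [_ [x /= x0 <-]|x /=].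
  by move: x0; rewrite !in_itv/= ltr_pM2l// pmulr_rgt0.
rewrite in_itv/= => /andP[x0 xv].
exists (x / c); last by rewrite mulrC divfK ?gt_eqF.
by rewrite /= in_itv/= divr_gt0//= ltr_pdivrMr// mulrC.
Qed.

End open_itv0.

(** * Real powers and their integral near 0 *)

Section powR_facts.
Context {R : realType}.
Notation mu := (@lebesgue_measure R).

Lemma powRVl (x a : R) : 0 <= x -> x^-1 `^ a = (x `^ a)^-1.
Proof. by move=> x0; rewrite -powR_inv1// -powRrM mulN1r powRN. Qed.

Lemma continuous_powR (a x : R) : 0 < x ->
  {for x, continuous (fun y : R => y `^ a)}.
Proof.
move=> x0; apply/differentiable_continuous/derivable1_diffP.
by apply: derivable_powR; rewrite in_itv/= andbT.
Qed.

Lemma integral_powR_itv01 (a : R) : 0 < a ->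
  (\int[mu]_(x in `]0%R, 1%R[) (x `^ (a - 1))%:E = (a^-1)%:E)%E.
Proof.
move=> a0; have aE : a != 0 by rewrite gt_eqF.
have hb : open_right (BLeft (1 : R)) by right; exists 1.
have imI : (fun x : R => x `^ a) @` `]0, 1[ = `]0, 1[%classic.
  apply/seteqP; split=> [_ [x /= + <-]|y /=]; rewrite !in_itv/= => /andP[x0 x1].
    rewrite powR_gt0//=.
    have := gt0_ltr_powR a0 _ _ x1.
    by rewrite powR1; apply; rewrite nnegrE// ltW.
  exists (y `^ a^-1); last by rewrite -powRrM mulVf// powRr1 ?ltW.
  rewrite /= in_itv/= powR_gt0//=.
  have := @gt0_ltr_powR _ a^-1 _ y 1 _ _ x1.
  by rewrite powR1 invr_gt0; apply; rewrite ?nnegrE// ltW.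
have : (\int[mu]_(y in (fun x : R => (x `^ a)%R) @` `]0%R, 1%R[)
          (cst 1%R y)%:E =
        \int[mu]_(x in `]0%R, 1%R[)
          (cst 1 (x `^ a) * (a * x `^ (a - 1)))%R%:E)%E.
  apply: (ge0_integration_by_substitution_itv0 hb) => [x y|x|x _|x|//|].
  - move=> /set_mem/mem_itv0_gt0/ltW x0 /set_mem/mem_itv0_gt0/ltW y0.
    by apply: gt0_ltr_powR => //; rewrite nnegrE.
  - by move=> /mem_itv0_gt0; exact: is_derive1_powR.
  - by rewrite mulr_ge0 ?powR_ge0// ltW.
  - move=> /mem_itv0_gt0 x0; apply: (@continuousM _ _ (cst a)).
      exact: cst_continuous.
    exact: continuous_powR.
  - by move=> ? _; exact: cst_continuous.
rewrite imI; under [in X in _ = X -> _]eq_integral do rewrite /= mul1r EFinM.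
rewrite [X in X = _ -> _](eq_integral (cst 1%E))//.
rewrite integral_cst//= mul1e.
rewrite lebesgue_measure_itv/= lte01 oppr0 adde0.
rewrite ge0_integralZl//=; last 3 first.
- apply/measurable_EFinP; apply: measurable_funTS; exact: measurable_powR.
- by move=> x _; rewrite lee_fin powR_ge0.
- by rewrite lee_fin ltW.
move=> /(congr1 (mule (a^-1)%:E)).
by rewrite muleA mule1 -EFinM mulVf// mul1e.
Qed.

End powR_facts.

(** * Convergence and positivity of the Gamma integral *)

Section Gamma_facts.
Context {R : realType}.
Notation mu := (@lebesgue_measure R).
Implicit Types a t : R.

Lemma measurable_Gamma_integrand a (D : set R) :
  measurable_fun D (fun t : R => t `^ (a - 1) * expR (- t)).
Proof.
apply: measurable_funTS; apply: measurable_funM; first exact: measurable_powR.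
by apply: measurableT_comp => //; exact: measurable_funN.
Qed.

Lemma Gamma_integrand_ge0 a t : 0 <= t `^ (a - 1) * expR (- t).
Proof. by rewrite mulr_ge0 ?powR_ge0 ?expR_ge0. Qed.

(* The tangent inequality [ln z <= z - 1] at [z = t / (2 a)]. *)
Lemma powR_le_expR a t : 0 < a -> 0 < t ->
  t `^ a <= expR (a * ln (2 * a) - a) * expR (t / 2).
Proof.
move=> a0 t0; rewrite -expRD /powR gt_eqF// ler_expR.
have a20 : 0 < 2 * a by rewrite mulr_gt0.
have z0 : 0 < t / (2 * a) by rewrite divr_gt0.
have := @le_ln1Dx _ (t / (2 * a) - 1).
rewrite addrCA subrr addr0 ltrBrDl subrr => /(_ z0).
rewrite ln_div ?posrE// -(ler_pM2l a0) mulrBr.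
have -> : a * (t / (2 * a) - 1) = t / 2 - a by field; rewrite gt_eqF.
by lra.
Qed.

(** The integral is split at 1. Below 1 the exponential is at most 1 and a power integral remains;
    above 1 the integrand is at most a constant times [expR (- t / 2)]. *)
Lemma integral_Gamma_lty a : 0 < a ->
  (\int[mu]_(t in `]0%R, +oo[) (t `^ (a - 1) * expR (- t))%:E < +oo)%E.
Proof.
move=> a0.
have -> : `]0, +oo[%classic = `]0, 1[%classic `|` `[1, +oo[%classic :> set R.
  by rewrite -itv_bndbnd_setU// bnd_simp.
rewrite ge0_integral_setU//=; last 3 first.
- by apply/measurable_EFinP; exact: measurable_Gamma_integrand.
- by move=> x _; rewrite lee_fin Gamma_integrand_ge0.
- apply/disj_setPS => x [] /=; rewrite !in_itv/= andbT => /andP[_ x1].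
  by rewrite leNgt x1.
apply: lte_add_pinfty.
  apply: (@le_lt_trans _ _ (\int[mu]_(t in `]0%R, 1%R[) (t `^ (a - 1))%:E)%E);
    last by rewrite integral_powR_itv01// ltry.
  apply: ge0_le_integral => //=.
  - by move=> x _; rewrite lee_fin Gamma_integrand_ge0.
  - by apply/measurable_EFinP; exact: measurable_Gamma_integrand.
  - by apply/measurable_EFinP; apply: measurable_funTS; exact: measurable_powR.
  - move=> x; rewrite in_itv/= => /andP[x0 _]; rewrite lee_fin.
    by rewrite ler_piMr ?powR_ge0// -expR0 ler_expR oppr_le0 ltW.
set C := expR (a * ln (2 * a) - a).
(* The factor 2 offsets the rate [2^-1] in front of the exponential density. *)
have C0 : 0 <= C * 2 by rewrite mulr_ge0 ?expR_ge0.
have mpdf : measurable_fun [set: R] (EFin \o exponential_pdf (2^-1 : R)).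
  by apply/measurable_EFinP; exact: measurable_exponential_pdf.
have pdf0 x : (0 <= (exponential_pdf (2^-1 : R) x)%:E)%E.
  by rewrite lee_fin exponential_pdf_ge0.
apply: (@le_lt_trans _ _
  (\int[mu]_t ((C * 2)%:E * (exponential_pdf 2^-1 t)%:E))%E); last first.
  by rewrite ge0_integralZl// integral_exponential_pdf// mule1 ltry.
apply: (@le_trans _ _
  (\int[mu]_(t in `[1%R, +oo[) ((C * 2)%:E * (exponential_pdf 2^-1 t)%:E))%E).
  apply: ge0_le_integral => //=.
  - by move=> x _; rewrite lee_fin Gamma_integrand_ge0.
  - by apply/measurable_EFinP; exact: measurable_Gamma_integrand.
  - by apply: measurable_funTS; exact: measurable_funeM.
  - move=> x; rewrite in_itv/= andbT => x1.
    have x0 : 0 < x by rewrite (lt_le_trans _ x1).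
    rewrite -EFinM lee_fin exponential_pdfE; last exact: ltW.
    rewrite /= mulrA mulfK//.
    have -> : expR (- 2^-1 * x) = expR (x / 2) * expR (- x) :> R.
      by rewrite -expRD; congr expR; field.
    rewrite mulrA ler_wpM2r ?expR_ge0//.
    apply: le_trans (powR_le_expR a0 x0).
    by rewrite ler_powR// lerBlDr lerDl.
apply: ge0_subset_integral => //=; first exact: measurable_funeM.
by move=> x _; rewrite mule_ge0// lee_fin.
Qed.

(** [Gamma] is a real-valued integral, which would read an infinite value as 0; convergence lets it
    be exchanged with the extended-real integral. *)
Lemma GammaE a : 0 < a ->
  (\int[mu]_(t in `]0%R, +oo[) (t `^ (a - 1) * expR (- t))%:E)%E = (Gamma a)%:E.
Proof.
move=> a0; rewrite /Gamma /Rintegral fineK// ge0_fin_numE ?integral_Gamma_lty//.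
by apply: integral_ge0 => t _; rewrite lee_fin Gamma_integrand_ge0.
Qed.

(** A zero integral would make the nonnegative integrand vanish almost everywhere; as it is positive
    at every [t > 0], the whole half-line would lie in a null set. *)
Lemma Gamma_gt0 a : 0 < a -> 0 < Gamma a.
Proof.
move=> a0; rewrite lt0r; apply/andP; split; last first.
  by rewrite -lee_fin -GammaE//; apply: integral_ge0 => t _;
    rewrite lee_fin Gamma_integrand_ge0.
apply/eqP => G0; have := GammaE a0; rewrite G0.
under eq_integral do
  rewrite -(@gee0_abs _ (_%:E)) ?lee_fin ?Gamma_integrand_ge0//.
move/ae_eq_integral_abs => /(_ (measurable_itv _)).
move=> /(_ ((measurable_EFinP _ _).2 (@measurable_Gamma_integrand a _))).
case=> N [mN N0 sub].
have : (mu `]0%R, +oo[ <= mu N)%E.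
  apply: le_measure; rewrite ?inE//; apply: subset_trans sub => x x0 /(_ x0)[].
  move: x0; rewrite /= in_itv/= andbT => x0 /eqP.
  by rewrite mulf_eq0 !gt_eqF ?powR_gt0 ?expR_gt0.
by rewrite N0 lebesgue_measure_itv/= ltry.
Qed.

End Gamma_facts.

(** Tonelli's theorem on the full product, applied to [k] extended by zero outside the rectangle. *)
Lemma fubini_tonelli_setX {d1 d2 : measure_display} {T1 : measurableType d1}
    {T2 : measurableType d2} {R : realType}
    (m1 : {sigma_finite_measure set T1 -> \bar R})
    (m2 : {sigma_finite_measure set T2 -> \bar R})
    (D : set T1) (E : set T2) (k : T1 * T2 -> \bar R) :
  measurable D -> measurable E -> measurable_fun [set: T1 * T2] k ->
  (forall z, (0 <= k z)%E) ->
  (\int[m1]_(x in D) \int[m2]_(y in E) k (x, y) =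
   \int[m2]_(y in E) \int[m1]_(x in D) k (x, y))%E.
Proof.
move=> mD mE mk k0.
have mkDE : measurable_fun [set: T1 * T2] (k \_ (D `*` E)).
  apply/(measurable_restrictT _ _).1; first exact: measurableX.
  exact: measurable_funTS.
have kDE0 z : (0 <= (k \_ (D `*` E)) z)%E by exact: erestrict_ge0.
rewrite integral_mkcond [RHS]integral_mkcond.
transitivity (\int[m1]_x \int[m2]_y (k \_ (D `*` E)) (x, y))%E.
  apply: eq_integral => x _; rewrite patchE; case: ifPn => xD.
    rewrite integral_mkcond; apply: eq_integral => y _.
    by rewrite !patchE in_setX xD.
  by rewrite integral0_eq// => y _; rewrite patchE in_setX (negbTE xD).
rewrite fubini_tonelli//; apply: eq_integral => y _.
rewrite patchE; case: ifPn => yE.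
  rewrite [RHS]integral_mkcond; apply: eq_integral => x _.
  by rewrite !patchE in_setX yE andbT.
by rewrite integral0_eq// => x _; rewrite patchE in_setX (negbTE yE) andbF.
Qed.

(** * The beta integral over the half-line *)

Section Beta_facts.
Context {R : realType}.
Notation mu := (@lebesgue_measure R).
Implicit Types a b s c t x v : R.

Lemma Beta_gt0 a b : 0 < a -> 0 < b -> 0 < Beta a b.
Proof. by move=> a0 b0; rewrite divr_gt0 ?mulr_gt0 ?Gamma_gt0 ?addr_gt0. Qed.

Lemma measurable_powR_expR s c (D : set R) :
  measurable_fun D (fun t : R => t `^ (s - 1) * expR (- (c * t))).
Proof.
apply: measurable_funTS; apply: measurable_funM; first exact: measurable_powR.
apply: measurableT_comp => //; apply: measurable_funN.
exact: measurable_funM.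
Qed.

(** Scaling by [c] in the integral for [Gamma s] produces the factor [c]^ (s - 1) * c = c [^ s]. *)
Lemma integral_powR_expR s c : 0 < s -> 0 < c ->
  (\int[mu]_(t in `]0%R, +oo[) (t `^ (s - 1) * expR (- (c * t)))%:E =
   (Gamma s / c `^ s)%:E)%E.
Proof.
move=> s0 c0.
have hb : @open_right R +oo%O by left.
have cs0 : c `^ s != 0 by rewrite gt_eqF// powR_gt0.
set J := (\int[mu]_(_ in _) _)%E.
suff : ((Gamma s)%:E = (c `^ s)%:E * J)%E.
  move=> /(congr1 (mule (c `^ s)^-1%:E)).
  by rewrite muleA -!EFinM mulVf// mul1e mulrC => <-.
rewrite -GammaE// -[in LHS](image_scale_itv0y c0) ge0_integral_itv0_scale//.
- rewrite -ge0_integralZl//=; last 3 first.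
  + by apply/measurable_EFinP; exact: measurable_powR_expR.
  + by move=> t _; rewrite lee_fin mulr_ge0 ?powR_ge0 ?expR_ge0.
  + by rewrite lee_fin powR_ge0.
  apply: eq_integral => t; rewrite inE/= in_itv/= andbT => t0.
  rewrite -EFinM; congr EFin.
  rewrite powRM ?(ltW c0) ?(ltW t0)// -(mulr_powRB1 (ltW c0) s0).
  by ring.
- by move=> x _; exact: Gamma_integrand_ge0.
- move=> x x0; apply: continuousM; first exact: continuous_powR.
  apply: continuous_comp; first exact: (@continuousN _ R^o _ id).
  exact: continuous_expR.
Qed.

Lemma measurable_Beta2_integrand s c (D : set R) :
  measurable_fun D (fun x : R => x `^ (s - 1) / (1 + x) `^ c).
Proof.
apply: measurable_funTS; apply: measurable_funM; first exact: measurable_powR.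
under eq_fun do rewrite -powRN.
apply: (measurableT_comp (measurable_powR _)); exact: measurable_funD.
Qed.

Lemma integral_Beta2 a b : 0 < a -> 0 < b ->
  (\int[mu]_(x in `]0%R, +oo[) (x `^ (a - 1) / (1 + x) `^ (a + b))%:E =
   (Beta a b)%:E)%E.
Proof.
move=> a0 b0; have ab0 : 0 < a + b by exact: addr_gt0.
pose k (z : R * R) : R :=
  z.1 `^ (a - 1) * (z.2 `^ (a + b - 1) * expR (- ((1 + z.1) * z.2))).
have k0 z : (0 <= (k z)%:E)%E by rewrite lee_fin !mulr_ge0 ?powR_ge0 ?expR_ge0.
have mk : measurable_fun [set: R * R] (EFin \o k).
  apply/measurable_EFinP; apply: measurable_funM.
    exact: (measurableT_comp (measurable_powR _) measurable_fst).
  apply: measurable_funM.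
    exact: (measurableT_comp (measurable_powR _) measurable_snd).
  apply: (measurableT_comp (@measurable_expR R)); apply: measurable_funN.
  by apply: measurable_funM; [exact: measurable_funD|exact: measurable_snd].
have intx x : 0 < x -> (\int[mu]_(t in `]0%R, +oo[) (k (x, t))%:E =
    (Gamma (a + b))%:E * (x `^ (a - 1) / (1 + x) `^ (a + b))%:E)%E.
  move=> x0; under eq_integral do rewrite EFinM/=.
  rewrite ge0_integralZl//=; last 3 first.
  - by apply/measurable_EFinP; exact: measurable_powR_expR.
  - by move=> t _; rewrite lee_fin mulr_ge0 ?powR_ge0 ?expR_ge0.
  - by rewrite lee_fin powR_ge0.
  rewrite integral_powR_expR ?addr_gt0// -!EFinM; congr EFin.
  by rewrite mulrCA.
have intt t : 0 < t -> (\int[mu]_(x in `]0%R, +oo[) (k (x, t))%:E =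
    (Gamma a)%:E * (t `^ (b - 1) * expR (- t))%:E)%E.
  move=> t0; transitivity (\int[mu]_(x in `]0%R, +oo[)
      ((t `^ (a + b - 1) * expR (- t))%:E *
       (x `^ (a - 1) * expR (- (t * x)))%:E))%E.
    apply: eq_integral => x _; rewrite -EFinM; congr EFin; rewrite /k/=.
    have -> : - ((1 + x) * t) = - t + - (t * x) by ring.
    by rewrite expRD; ring.
  rewrite ge0_integralZl//=; last 3 first.
  - by apply/measurable_EFinP; exact: measurable_powR_expR.
  - by move=> x _; rewrite lee_fin mulr_ge0 ?powR_ge0 ?expR_ge0.
  - by rewrite lee_fin mulr_ge0 ?powR_ge0 ?expR_ge0.
  rewrite integral_powR_expR// -!EFinM; congr EFin.
  have -> : a + b - 1 = a + (b - 1) by ring.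
  rewrite powRD; last by apply/implyP => _; rewrite gt_eqF.
  by field; rewrite gt_eqF// powR_gt0.
have : (\int[mu]_(x in `]0%R, +oo[)
      ((Gamma (a + b))%:E * (x `^ (a - 1) / (1 + x) `^ (a + b))%:E) =
    \int[mu]_(t in `]0%R, +oo[)
      ((Gamma a)%:E * (t `^ (b - 1) * expR (- t))%:E))%E.
  transitivity (\int[mu]_(x in `]0%R, +oo[) \int[mu]_(t in `]0%R, +oo[)
      (k (x, t))%:E)%E.
    by apply: eq_integral => x; rewrite inE/= in_itv/= andbT => /intx.
  rewrite (fubini_tonelli_setX mu mu (measurable_itv _) (measurable_itv _) mk k0).
  by apply: eq_integral => t; rewrite inE/= in_itv/= andbT => /intt.
rewrite ge0_integralZl//=; last 3 first.
- by apply/measurable_EFinP; exact: measurable_Beta2_integrand.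
- by move=> x _; rewrite lee_fin divr_ge0 ?powR_ge0.
- by rewrite lee_fin ltW ?Gamma_gt0.
rewrite [X in _ = X -> _]ge0_integralZl//=; last 3 first.
- by apply/measurable_EFinP; exact: measurable_Gamma_integrand.
- by move=> t _; rewrite lee_fin Gamma_integrand_ge0.
- by rewrite lee_fin ltW ?Gamma_gt0.
rewrite GammaE// => /(congr1 (mule (Gamma (a + b))^-1%:E)).
rewrite muleA -!EFinM mulVf ?gt_eqF ?Gamma_gt0// mul1e => ->.
by rewrite mulrC.
Qed.

End Beta_facts.

(** * The truncated beta integral *)

Section Beta2_moments.
Context {R : realType}.
Notation mu := (@lebesgue_measure R).
Implicit Types a b c p q r v x : R.

Lemma ge0_integral_itv0_mobius (G : R -> R) v : 0 < v ->
  (forall x, 0 < x < 1 -> 0 <= G x) ->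
  (forall x, 0 < x < 1 -> {for x, continuous G}) ->
  (\int[mu]_(t in `]0%R, (v / (1 + v))%R[) (G t)%:E =
   \int[mu]_(x in `]0%R, v[) (G (x / (1 + x)) * (1 + x) ^- 2)%:E)%E.
Proof.
(* This form of [x / (1 + x)] makes its monotonicity and its derivative [(1 + x) ^- 2] immediate. *)
move=> v0 G0 cG; pose F x := 1 - (1 + x)^-1.
have hb : open_right (BLeft v) by right; exists v.
have Sx x : 0 < x -> 0 < 1 + x by move=> x0; rewrite addr_gt0.
have FE x : 0 < x -> F x = x / (1 + x).
  by move=> x0; rewrite /F; field; rewrite gt_eqF// Sx.
have F01 x : 0 < x -> 0 < F x < 1.
  move=> x0; apply/andP; split; last by rewrite gtrBl invr_gt0 Sx.
  by rewrite subr_gt0 invf_lt1 ?Sx// ltrDl.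
have F_lt x y : 0 < x -> 0 < y -> (F x < F y) = (x < y).
  by move=> x0 y0; rewrite /F ltrD2l ltrN2 ltf_pV2 ?posrE ?Sx// ltrD2l.
have -> : `]0, (v / (1 + v))[%classic = F @` `]0, v[.
  apply/seteqP; split=> [t /=|_ [x /= + <-]]; rewrite !in_itv/=; last first.
    move=> /andP[x0 xv]; rewrite -FE// F_lt// xv.
    by case/andP: (F01 _ x0) => ->.
  rewrite -FE// => /andP[t0 tv].
  have t1 : t < 1 by rewrite (lt_trans tv)//; case/andP: (F01 v v0).
  have t10 : 0 < 1 - t by rewrite subr_gt0.
  have Ft : F (t / (1 - t)) = t by rewrite /F; field; rewrite !gt_eqF//; lra.
  have t'0 : 0 < t / (1 - t) by rewrite divr_gt0.
  (* The witness is the inverse of [F] at [t]. *)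
  by exists (t / (1 - t)) => //=; rewrite in_itv/= t'0 -F_lt// Ft.
transitivity (\int[mu]_(x in `]0%R, v[) (G (F x) * (1 + x) ^- 2)%:E)%E;
  last first.
  by apply: eq_integral => x /set_mem/mem_itv0_gt0 x0; rewrite FE.
apply: (ge0_integration_by_substitution_itv0 hb) => [x y|x|x _|x|x|x].
- by move=> /set_mem/mem_itv0_gt0 x0 /set_mem/mem_itv0_gt0 y0; rewrite F_lt.
- move=> /mem_itv0_gt0 x0.
  have h : is_derive x 1 (fun y => (1 + y)^-1) (- (1 + x) ^- 2 *: (0 + 1)).
    by apply: is_deriveV; rewrite gt_eqF// Sx.
  apply: is_derive_eq.
  by rewrite !add0r mul1r scaleNr opprK scaler1.
- by rewrite invr_ge0 sqr_ge0.
- move=> /mem_itv0_gt0 x0; apply: continuousV.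
    by rewrite expf_neq0// gt_eqF// Sx.
  have cS : {for x, continuous (fun y : R => 1 + y)}.
    by apply: continuousD; [exact: cst_continuous|exact: cvg_id].
  exact: (continuous_comp cS (@exprn_continuous _ 2 _)).
- by move=> /mem_itv0_gt0/F01; exact: G0.
- by move=> /mem_itv0_gt0/F01; exact: cG.
Qed.

Lemma integral_Beta2_itv0 a b v : 0 < a -> 0 < b -> 0 < v ->
  (\int[mu]_(x in `]0%R, v[) (x `^ (a - 1) / (1 + x) `^ (a + b))%:E =
   (Beta a b * inc_beta_ratio (v / (1 + v)) a b)%:E)%E.
Proof.
move=> a0 b0 v0; rewrite /inc_beta_ratio mulVKf ?gt_eqF ?Beta_gt0//.
pose G t : R := t `^ (a - 1) * (1 - t) `^ (b - 1).
have mG : measurable_fun [set: R] G.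
  apply: measurable_funM; first exact: measurable_powR.
  by apply: (measurableT_comp (measurable_powR _)); exact: measurable_funB.
have GE : (\int[mu]_(x in `]0%R, v[) (x `^ (a - 1) / (1 + x) `^ (a + b))%:E =
           \int[mu]_(t in `]0%R, (v / (1 + v))%R[) (G t)%:E)%E.
  rewrite ge0_integral_itv0_mobius//.
  - apply: eq_integral => x /set_mem/mem_itv0_gt0 x0; congr EFin.
    have y0 : 0 < 1 + x by rewrite addr_gt0.
    have yE : 1 + x != 0 by rewrite gt_eqF.
    have -> : G (x / (1 + x)) =
        (x / (1 + x)) `^ (a - 1) * ((1 + x)^-1) `^ (b - 1).
      by rewrite /G; congr (_ * _ `^ _); field.
    rewrite powRM ?invr_ge0 ?(ltW x0) ?(ltW y0)// !powRVl ?(ltW y0)//.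
    (* The exponents [a - 1] and [b - 1] come from the two factors of [G], and the square from the
       derivative of the substitution. *)
    have -> : (1 + x) `^ (a + b) =
        (1 + x) `^ (a - 1) * ((1 + x) `^ (b - 1) * (1 + x) ^+ 2).
      rewrite -powR_mulrn ?(ltW y0)// -!powRD; try by apply/implyP.
      by congr (_ `^ _); ring.
    by field; rewrite !gt_eqF ?powR_gt0.
  - by move=> x _; rewrite mulr_ge0 ?powR_ge0.
  - move=> x /andP[x0 x1]. apply: continuousM; first exact: continuous_powR.
    have c1 : {for x, continuous (fun y : R => 1 - y)}.
      by apply: continuousB; [exact: cst_continuous|exact: cvg_id].
    have x10 : 0 < 1 - x by rewrite subr_gt0.
    exact: (continuous_comp c1 (@continuous_powR _ (b - 1) _ x10)).
(* The real-valued integral in [inc_beta_ratio] is faithful only if finite: [GE] turns it into a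
   part of the half-line integral, bounded by [Beta a b]. Passing between the closed and the open
   interval only changes null end points. *)
rewrite GE /Rintegral fineK; last first.
  rewrite -integral_itv_bndo_bndc; last first.
    by apply/measurable_EFinP; exact: measurable_funTS.
  rewrite -integral_itv_obnd_cbnd; last first.
    by apply/measurable_EFinP; exact: measurable_funTS.
  rewrite -GE ge0_fin_numE; last first.
    by apply: integral_ge0 => x _; rewrite lee_fin divr_ge0 ?powR_ge0.
  apply: (@le_lt_trans _ _ (Beta a b)%:E); last exact: ltry.
  rewrite -integral_Beta2//; apply: ge0_subset_integral => //=.
  - by apply/measurable_EFinP; exact: measurable_Beta2_integrand.
  - by move=> x _; rewrite lee_fin divr_ge0 ?powR_ge0.
  - by apply: subset_itvl; rewrite bnd_simp.
rewrite -integral_itv_bndo_bndc; last first.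
  by apply/measurable_EFinP; exact: measurable_funTS.
rewrite -[RHS]integral_itv_obnd_cbnd//.
by apply/measurable_EFinP; exact: measurable_funTS.
Qed.

End Beta2_moments.

(** * Full and truncated moments of the second kind beta density *)

Section beta2_pdf_facts.
Context {R : realType}.
Notation mu := (@lebesgue_measure R).
Variables (p q beta : R).
Hypotheses (p0 : 0 < p) (q0 : 0 < q) (beta0 : 0 < beta).
Local Notation pdf := (beta2_pdf p q beta).
(** The density formula without the sign test: it agrees with [pdf] at positive points, and its
    continuity there follows factor by factor. *)
Local Notation pos_pdf :=
  (fun x : R =>
     x `^ (p - 1) / (beta `^ p * Beta p q * (1 + x / beta) `^ (p + q))).

Lemma beta2_pdf_ge0 x : 0 <= pdf x.
Proof.
rewrite /beta2_pdf; case: ifPn => // x0.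
have B0 := ltW (Beta_gt0 p0 q0).
by apply: divr_ge0 (powR_ge0 _ _) (mulr_ge0 (mulr_ge0 _ B0) _); exact: powR_ge0.
Qed.

Lemma measurable_beta2_pdf : measurable_fun [set: R] pdf.
Proof.
have -> : pdf = pos_pdf \_ `]0, +oo[.
  by apply/funext => x; rewrite patchE mem_setE in_itv/= andbT.
apply/(measurable_restrictT _ _).1 => //; apply: measurable_funTS.
apply: measurable_funM; first exact: measurable_powR.
under eq_fun do rewrite invfM -powRN.
apply: measurable_funM => //; apply: (measurableT_comp (measurable_powR _)).
by apply: measurable_funD => //; exact: measurable_funM.
Qed.

Lemma measurable_beta2_moment r :
  measurable_fun [set: R] (fun x => x `^ r * pdf x).
Proof.
apply: measurable_funM; first exact: measurable_powR.
exact: measurable_beta2_pdf.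
Qed.

(** Under [x = beta * y] the powers of [beta] collect to [beta]^ (r + (p - 1) + 1 -
    p)[, that is]beta [^ r]. *)
Lemma integral_beta2_moment r b : open_right b ->
  (\int[mu]_(x in *%R beta @` [set` Interval (BRight 0%R) b])
     (x `^ r * pdf x)%:E =
   (beta `^ r / Beta p q)%:E *
   \int[mu]_(y in [set` Interval (BRight 0%R) b])
     (y `^ (p + r - 1) / (1 + y) `^ (p + q))%:E)%E.
Proof.
move=> hb; set I := [set` _]; have B0 := Beta_gt0 p0 q0.
transitivity (\int[mu]_(x in *%R beta @` I) (x `^ r * pos_pdf x)%:E)%E.
  apply: eq_integral => _ /set_mem[x /mem_itv0_gt0 x0 <-].
  by rewrite /beta2_pdf mulr_gt0.
rewrite (ge0_integral_itv0_scale beta0 hb); last 2 first.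
- move=> x x0; apply: mulr_ge0 (powR_ge0 _ _) (divr_ge0 (powR_ge0 _ _) _).
  by apply: mulr_ge0 (mulr_ge0 _ (ltW B0)) _; exact: powR_ge0.
- move=> x x0; apply: continuousM; first exact: continuous_powR.
  apply: continuousM; first exact: continuous_powR.
  have y0 : 0 < 1 + x / beta by rewrite addr_gt0// divr_gt0.
  apply: continuousV.
    by apply: mulf_neq0 (mulf_neq0 _ _) _; rewrite gt_eqF ?powR_gt0.
  apply: continuousM; first exact: cst_continuous.
  have cS : {for x, continuous (fun y : R => 1 + y / beta)}.
    apply: continuousD; first exact: cst_continuous.
    by apply: continuousM; [exact: cvg_id|exact: cst_continuous].
  exact: (continuous_comp cS (@continuous_powR _ (p + q) _ y0)).
rewrite -ge0_integralZl//=; last 4 first.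
- by rewrite /I; case: hb => [->|[v _ ->]].
- by apply/measurable_EFinP; exact: measurable_Beta2_integrand.
- by move=> x _; rewrite lee_fin divr_ge0 ?powR_ge0.
- by rewrite lee_fin divr_ge0 ?powR_ge0 ?(ltW B0).
apply: eq_integral => x /set_mem/mem_itv0_gt0 x0; rewrite -EFinM; congr EFin.
have xn : x != 0 by rewrite gt_eqF.
have bn : beta != 0 by rewrite gt_eqF.
have -> : beta * x / beta = x by field.
rewrite !powRM ?(ltW beta0) ?(ltW x0)//.
have -> : x `^ (p + r - 1) = x `^ r * x `^ (p - 1).
  by rewrite -powRD; [congr (_ `^ _); ring|apply/implyP].
rewrite -(mulr_powRB1 (ltW beta0) p0).
field; rewrite !gt_eqF ?powR_gt0//.
by rewrite addr_gt0.
Qed.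

Lemma integral_beta2_moment_itv0y r : - p < r -> r < q ->
  (\int[mu]_(x in `]0%R, +oo[) (x `^ r * pdf x)%:E =
   (beta `^ r / Beta p q * Beta (p + r) (q - r))%:E)%E.
Proof.
move=> pr rq; rewrite -(image_scale_itv0y beta0).
rewrite integral_beta2_moment; last by left.
(* This exhibits the parameters [p + r] and [q - r], both positive by the bounds on [r]. *)
have -> : p + q = (p + r) + (q - r) by ring.
by rewrite integral_Beta2 ?EFinM//; lra.
Qed.

Lemma integral_beta2_moment_itv0o r c : - p < r -> r < q -> 0 < c ->
  (\int[mu]_(x in `]0%R, c[) (x `^ r * pdf x)%:E =
   (beta `^ r / Beta p q * (Beta (p + r) (q - r) *
     inc_beta_ratio ((c / beta) / (1 + c / beta)) (p + r) (q - r)))%:E)%E.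
Proof.
move=> pr rq c0; have cb0 : 0 < c / beta by rewrite divr_gt0.
have -> : `]0%R, c[%classic = *%R beta @` `]0%R, (c / beta)[.
  by rewrite image_scale_itv0o// mulrC divfK ?gt_eqF.
rewrite integral_beta2_moment; last by right; exists (c / beta).
have -> : p + q = (p + r) + (q - r) by ring.
by rewrite integral_Beta2_itv0 ?EFinM//; lra.
Qed.

Lemma integral_beta2_moment_itvoy r c : - p < r -> r < q -> 0 < c ->
  (\int[mu]_(x in `]c, +oo[) (x `^ r * pdf x)%:E =
   (beta `^ r / Beta p q * Beta (p + r) (q - r) *
     (1 - inc_beta_ratio ((c / beta) / (1 + c / beta)) (p + r) (q - r)))%:E)%E.
Proof.
move=> pr rq c0; have := integral_beta2_moment_itv0y pr rq.
have -> : `]0, +oo[%classic = `]0, c]%classic `|` `]c, +oo[%classic :> set R.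
  by rewrite -itv_bndbnd_setU// bnd_simp// ltW.
have mh D : measurable_fun D (EFin \o (fun x : R => x `^ r * pdf x)).
  apply/measurable_EFinP; apply: measurable_funTS.
  exact: measurable_beta2_moment.
rewrite ge0_integral_setU//=; last 3 first.
- exact: mh.
- by move=> x _; rewrite lee_fin mulr_ge0 ?powR_ge0 ?beta2_pdf_ge0.
- apply/disj_setPS => x [] /=; rewrite !in_itv/= andbT => /andP[_ x1].
  by rewrite ltNge x1.
rewrite -integral_itv_bndo_bndc// integral_beta2_moment_itv0o//.
set J := (X in (_ + X)%E) => h.
have {h} : (J + (beta `^ r / Beta p q * (Beta (p + r) (q - r) *
     inc_beta_ratio ((c / beta) / (1 + c / beta)) (p + r) (q - r)))%:E =
   (beta `^ r / Beta p q * Beta (p + r) (q - r))%:E)%E by rewrite addeC.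
(* Subtraction is sound in the extended reals because the moment over []0, c[] is a finite real. *)
move=> /(congr1 (fun z => z - (beta `^ r / Beta p q * (Beta (p + r) (q - r) *
     inc_beta_ratio ((c / beta) / (1 + c / beta)) (p + r) (q - r)))%:E)%E).
rewrite addeK// => JE; transitivity J => //.
by rewrite JE -EFinB; congr EFin; ring.
Qed.

End beta2_pdf_facts.

(** The density [g] has the same integral as the Radon-Nikodym derivative of [nu] over every
    measurable set, hence equals it almost everywhere; the change of variables formula for that
    derivative then transfers to [g]. *)
Lemma ge0_integral_density {d : measure_display} {T : measurableType d}
    {R : realType} (nu : {finite_measure set T -> \bar R})
    (mu : {sigma_finite_measure set T -> \bar R})
    (g : T -> R) (f : T -> \bar R) :
  measurable_fun [set: T] g -> (forall x, 0 <= g x) ->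
  (forall A, measurable A -> nu A = (\int[mu]_(x in A) (g x)%:E)%E) ->
  measurable_fun [set: T] f -> (forall x, (0 <= f x)%E) ->
  (\int[nu]_x f x = \int[mu]_x (f x * (g x)%:E))%E.
Proof.
move=> mg g0 nuE mf f0.
have mgE (D : set T) : measurable_fun D (EFin \o g).
  by apply/measurable_EFinP; exact: measurable_funTS.
have numu : nu `<< mu.
  apply/null_content_dominatesP => A mA A0.
  by rewrite [LHS]nuE// null_set_integral.
(* The total integral of [g] is the finite mass of [nu]; integrability is what almost everywhere
   uniqueness asks for. *)
have ig : mu.-integrable [set: T] (EFin \o g).
  apply/integrableP; split => //.
  under eq_integral do rewrite gee0_abs ?lee_fin//.
  by rewrite -nuE// -ge0_fin_numE// fin_num_measure.
pose h := Radon_Nikodym_SigmaFinite.f nu mu.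
have ih : mu.-integrable [set: T] h.
  exact: Radon_Nikodym_SigmaFinite.f_integrable.
have mh : measurable_fun [set: T] h by exact: measurable_int ih.
rewrite -(Radon_Nikodym_SigmaFinite.change_of_variables numu f0 measurableT mf).
apply: ae_eq_integral => //; [exact: emeasurable_funM|exact: emeasurable_funM|].
apply: ae_eqe_mul2l; apply: integral_ae_eq => // A _ mA.
by rewrite -nuE// -Radon_Nikodym_SigmaFinite.f_integral.
Qed.

(** * The distribution function at the value at risk *)

Section VaR_facts.
Context {d : measure_display} {T : measurableType d} {R : realType}
  {P : probability T R}.
Implicit Types (X : {RV P >-> R}) (u : R).

Lemma cdf_VaR X u : (forall x, distribution P X [set x] = 0%E) -> 0 < u < 1 ->
  cdf X (VaR X u) = u%:E.
Proof.
move=> X0 /andP[u0 u1]; rewrite /VaR; set S := [set x | _]; set x_u := inf S.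
have ndF := @cdf_nondecreasing _ _ _ P X.
(* The limits 1 and 0 of the distribution function at the two infinities, with [0 < u < 1], make [S]
   nonempty and bounded below. *)
have [M SM] : exists M, S M.
  apply: contrapT => /forallNP FltU.
  have : (1 <= u%:E :> \bar R)%E.
    apply: cvge_to_le (cvg_cdfy1 X) _; apply: nearW => x.
    by have /negP := FltU x; rewrite -ltNge => /ltW.
  by rewrite lee_fin leNgt u1.
have [m Fm] : exists m, (cdf X m < u%:E)%E.
  apply: contrapT => /forallNP uleF.
  have : (u%:E <= 0 :> \bar R)%E.
    apply: cvge_to_ge (cvg_cdfNy0 X) _; apply: nearW => x.
    by have /negP := uleF x; rewrite -leNgt.
  by rewrite lee_fin leNgt u0.
have lbS : has_lbound S.
  exists m => x Sx; rewrite leNgt; apply/negP => xm.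
  by have := lt_le_trans Fm Sx; rewrite ltNge ndF// ltW.
apply/eqP; rewrite eq_le; apply/andP; split; last first.
  (* Lower bound by [u]: every [y > x_u] exceeds a member of [S], so [u <= cdf X y], and right
     continuity carries this to [x_u]. *)
  apply: cvge_to_ge (@cdf_right_continuous _ _ _ P X x_u) _.
  near=> y; have [|x Sx xy] := @inf_lt _ S y (ex_intro _ _ SM).
    by near: y; exact: nbhs_right_gt.
  by apply: (le_trans Sx); apply: ndF; exact: ltW.
(* Upper bound by [u]: without an atom at [x_u] the value is the limit of [cdf X] along
   [x_u - n.+1%:R^-1], points below the infimum, where it stays under [u]. *)
have -> : cdf X x_u = distribution P X `]-oo, x_u[.
  rewrite /cdf -(@setUitv1 _ _ -oo%O x_u true) ?bnd_simp// measureU//.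
    by rewrite [X in (_ + X)%E]X0 adde0.
  by apply/seteqP; split => // x [] /= + xE; rewrite xE in_itv/= ltxx.
have itvE : `]-oo, x_u[%classic = \bigcup_n `]-oo, x_u - n.+1%:R^-1]%classic.
  apply/seteqP; split=> [x /=|x [n _ /=]]; rewrite !in_itv/=.
    move=> /ltr_add_invr[n xn]; exists n => //=.
    by rewrite in_itv/= lerBrDr ltW.
  by move=> /le_lt_trans; apply; rewrite ltrBlDr ltrDl.
rewrite itvE; set F := (fun n : nat => `]-oo, _]%classic).
have cvgF : (distribution P X \o F) n @[n --> \oo] -->
    distribution P X (\bigcup_n F n).
  apply: nondecreasing_cvg_mu => //; first by move=> n; exact: measurable_itv.
    by rewrite -itvE; exact: measurable_itv.
  move=> n k nk; apply/subsetPset; apply: subset_itvl.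
  by rewrite bnd_simp lerD2l lerN2 lef_pV2 ?posrE// ler_nat.
apply: cvge_to_le cvgF _.
apply: nearW => n; apply/ltW; rewrite ltNge; apply/negP => Sn.
have /(ge_inf lbS) : S (x_u - n.+1%:R^-1) by exact: Sn.
by rewrite -/x_u leNgt ltrBlDr ltrDl invr_gt0 ltr0n.
Unshelve. all: by end_near. Qed.

Lemma prob_gt_VaR X u :
  (forall x, distribution P X [set x] = 0%E) -> 0 < u < 1 ->
  P [set w | VaR X u < X w] = (1 - u)%:E.
Proof.
move=> X0 u01; have -> : [set w | VaR X u < X w] = X @^-1` `]VaR X u, +oo[.
  by apply/seteqP; split=> w /=; rewrite in_itv/= andbT.
have := cdf_ccdf_1 X (VaR X u); rewrite cdf_VaR// EFinB => <-.
by rewrite addeAC subee// add0e.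
Qed.

End VaR_facts.

(* [X] is recast along the carrier [measurableTypeR R] of [lebesgue_measure],
   which has the same measurable sets as [R] but a different structure. *)
Lemma ge0_integral_RV_density {d : measure_display} {T : measurableType d}
    {R : realType} (P : probability T R) (X : {RV P >-> R}) (g : R -> R)
    (f : R -> \bar R) :
  measurable_fun [set: R] g -> (forall x, 0 <= g x) ->
  (forall A, measurable A -> distribution P X A =
     (\int[@lebesgue_measure R]_(x in A) (g x)%:E)%E) ->
  measurable_fun [set: R] f -> (forall x, (0 <= f x)%E) ->
  (\int[P]_w f (X w) = \int[@lebesgue_measure R]_x (f x * (g x)%:E))%E.
Proof.
move=> mg g0 PXE mf f0.
have mX : @measurable_fun _ _ T (measurableTypeR R) [set: T] X.
  exact: (measurable_funP X).
pose mX' := isMeasurableFun.Build _ _ T (measurableTypeR R) X mX.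
pose X' : {RV P >-> measurableTypeR R} :=
  HB.pack (X : T -> measurableTypeR R) mX'.
transitivity (\int[distribution P X']_y f y)%E.
  by rewrite (ge0_integral_distribution X').
exact: ge0_integral_density.
Qed.

(** * Conditional tail moments of the second kind beta distribution *)

Unset Implicit Arguments.
Set Strict Implicit.

Theorem lemma2 (d : measure_display) (T : measurableType d) (R : realType)
    (P : probability T R) (X : {RV P >-> R}) (p q beta r u : R)
    (hp : 0 < p) (hq : 0 < q) (hbeta : 0 < beta)
    (hX : beta2_distributed X p q beta)
    (hu : 0 < u < 1)
    (hr : - p < r < q) :
  let x_u := VaR X u in
  cond_expectation P (fun w => X w `^ r) [set w | x_u < X w] =
  (beta `^ r * Gamma (p + r) * Gamma (q - r)
     / ((1 - u) * Gamma p * Gamma q)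
   * (1 - inc_beta_ratio ((x_u / beta) / (1 + x_u / beta)) (p + r) (q - r)))%:E.
Proof.
move=> x_u; have /andP[pr rq] := hr; have /andP[u0 u1] := hu.
have atomless x : distribution P X [set x] = 0%E.
  by rewrite hX// integral_set1.
(* If [x_u <= 0], the density vanishes on []-oo, x_u]] and the distribution function is 0 at [x_u],
   whereas it equals [u > 0]. *)
have x_u0 : 0 < x_u.
  rewrite ltNge; apply/negP => x_u_le0; have := cdf_VaR atomless hu.
  rewrite /cdf hX// integral0_eq => [[]/esym/eqP|x /=]; first by rewrite gt_eqF.
  by rewrite in_itv/= => xx_u; rewrite /beta2_pdf ltNge (le_trans xx_u).
rewrite /cond_expectation prob_gt_VaR// unlock.
(* The indicator of the event at [w] is that of [D] at [X w], so the numerator integrates a function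
   of [X w] alone and the density applies. *)
pose D : set R := `]x_u, +oo[%classic.
have mXr : measurable_fun [set: R] (fun x : R => (x `^ r * \1_D x)%:E).
  apply/measurable_EFinP; apply: measurable_funM; first exact: measurable_powR.
  by apply: measurable_indic; exact: measurable_itv.
transitivity ((\int[P]_w (X w `^ r * \1_D (X w))%:E) / (1 - u)%:E)%E.
  congr (_ / _)%E; apply: eq_integral => w _ /=; congr (_ * _)%:E.
  by rewrite !indicE !mem_setE in_itv/= andbT.
rewrite (@ge0_integral_RV_density _ _ _ P X (beta2_pdf p q beta) _ _ _ hX mXr).
have -> : (\int[@lebesgue_measure R]_x
      ((x `^ r * \1_D x)%:E * (beta2_pdf p q beta x)%:E) =
    \int[@lebesgue_measure R]_(x in D) (x `^ r * beta2_pdf p q beta x)%:E)%E.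
  rewrite [RHS]integral_mkcond; apply: eq_integral => x _.
  rewrite patchE indicE -EFinM.
  by case: (x \in D); rewrite ?mulr1 ?mulr0 ?mul0r.
rewrite integral_beta2_moment_itvoy// inver subr_eq0 gt_eqF// -EFinM.
(* Both beta values have the denominator [Gamma (p + q)], which therefore cancels in their
   quotient. *)
congr EFin; rewrite /Beta; have -> : p + r + (q - r) = p + q by ring.
have Gn (c : R) : 0 < c -> Gamma c != 0 by move=> /Gamma_gt0 Gc; rewrite gt_eqF.
have un : 1 - u != 0 by rewrite subr_eq0 gt_eqF.
move: (Gn _ hp) (Gn _ hq) (Gn _ (addr_gt0 hp hq)).
move: (Gamma p) (Gamma q) (Gamma (p + q)) (Gamma _) (Gamma _) (beta `^ r)
  (inc_beta_ratio _ _ _) => Gp Gq Gpq Ga Gb br J Gp0 Gq0 Gpq0.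
by field; rewrite un Gp0 Gq0 Gpq0.
- exact: measurable_beta2_pdf.
- exact: beta2_pdf_ge0.
- by move=> x; rewrite lee_fin mulr_ge0 ?powR_ge0.
Qed.
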